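(* Let $f:[0,\infty)\to[0,\infty)$ be amenable. Then the following statements are equivalent: (i) $f$ is ultrametric-metric-preserving; (ii) for each $(a,b,c)\in \Delta_\infty$, $(f(a),f(b),f(c))\in \Delta$; (iii) for all real $a,b$ with $0\leq a\leq b$, $f(a)\leq 2f(b)$.
   Context: An ultrametric space is a metric space $(X,d)$ satisfying $d(x,y)\leq \max\{d(x,z),d(z,y)\}$ for all $x,y,z\in X$. A function $f:[0,\infty)\to[0,\infty)$ is ultrametric-metric-preserving if for all ultrametric spaces $(X,d)$, $f\circ d$ is a metric on $X$. $f$ is amenable if $f^{-1}(\{0\})=\{0\}$. $\Delta$ is the set of all triangle triplets, i.e. triples $(a,b,c)$ of nonnegative real numbers with $a\leq b+c$, $b\leq c+a$, and $c\leq a+b$. $\Delta_\infty$ is the set of all ultra triangle triplets, i.e. triples $(a,b,c)$ of nonnegative real numbers with $a\leq\max\{b,c\}$, $b\leq\max\{c,a\}$, and $c\leq\max\{a,b\}$. *)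

(* Defs.v *)
(* Stdlib reals. *)
From Stdlib Require Export Reals.
Open Scope R_scope.

(* A function [0,oo) -> [0,oo) is represented by f : R -> R that maps
   nonnegative reals to nonnegative reals; its values at negative arguments
   are never used below. *)
Definition nonneg_fun (f : R -> R) : Prop :=
  forall x : R, 0 <= x -> 0 <= f x.

(* The preimage of {0}, taken inside [0,oo), is {0}. *)
Definition amenable (f : R -> R) : Prop :=
  forall x : R, 0 <= x -> (f x = 0 <-> x = 0).

(* Unbundled form of the Stdlib record Metric_Space, with the same axioms:
   it states that a given d, such as f o dist, is a metric on a given X. *)
Record is_metric (X : Type) (d : X -> X -> R) : Prop := {
  is_metric_pos : forall x y : X, d x y >= 0;
  is_metric_sym : forall x y : X, d x y = d y x;
  is_metric_refl : forall x y : X, d x y = 0 <-> x = y;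
  is_metric_tri : forall x y z : X, d x y <= d x z + d z y }.

Definition is_ultrametric_space (M : Metric_Space) : Prop :=
  forall x y z : Base M, dist M x y <= Rmax (dist M x z) (dist M z y).

Definition ultrametric_metric_preserving (f : R -> R) : Prop :=
  forall M : Metric_Space, is_ultrametric_space M ->
    is_metric (Base M) (fun x y => f (dist M x y)).

Definition triangle_triplet (a b c : R) : Prop :=
  (0 <= a /\ 0 <= b /\ 0 <= c) /\
  (a <= b + c /\ b <= c + a /\ c <= a + b).

Definition ultra_triangle_triplet (a b c : R) : Prop :=
  (0 <= a /\ 0 <= b /\ 0 <= c) /\
  (a <= Rmax b c /\ b <= Rmax c a /\ c <= Rmax a b).

(* Main.v *)
(* In an ultra triangle triplet the two largest entries coincide, so up to
   order the triplets are the (a, b, b) with a <= b, for which the only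
   nontrivial triangle inequality of the images is f a <= 2 f b.  Each such
   triplet with 0 < a is the set of sides of an isosceles three-point
   ultrametric space. *)
Require Import Defs.
From Stdlib Require Import Reals Lra.
Open Scope R_scope.

(* [None] is the apex, [Some true] and [Some false] are the ends of the base. *)
Definition isosceles_dist (a b : R) (x y : option bool) : R :=
  match x, y with
  | None, None => 0
  | Some p, Some q => if Bool.eqb p q then 0 else a
  | _, _ => b
  end.

(** Strict positivity of [a] keeps the two ends of the base distinct. The definition is transparent
    so that [simpl] can compute its distances. *)
Definition isosceles_space (a b : R) (a_pos : 0 < a) (a_le_b : a <= b) : Metric_Space.
Proof.
  refine (Build_Metric_Space (option bool) (isosceles_dist a b) _ _ _ _).
  - intros [[|]|] [[|]|]; simpl; lra.
  - intros [[|]|] [[|]|]; reflexivity.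
  - intros [[|]|] [[|]|]; simpl; split; intro H;
      first [reflexivity | discriminate | lra].
  - intros [[|]|] [[|]|] [[|]|]; simpl; lra.
Defined.

Lemma isosceles_ultrametric (a b : R) (a_pos : 0 < a) (a_le_b : a <= b) :
  is_ultrametric_space (isosceles_space a b a_pos a_le_b).
Proof.
  intros [[|]|] [[|]|] [[|]|]; simpl; unfold Rmax; destruct Rle_dec; lra.
Qed.

Lemma le_double_of_preserving (f : R -> R) (f_nonneg : nonneg_fun f)
    (f_amenable : amenable f) :
  ultrametric_metric_preserving f ->
  forall a b : R, 0 <= a -> a <= b -> f a <= 2 * f b.
Proof.
  intros f_pres a b a_nonneg a_le_b.
  destruct (Rle_lt_or_eq_dec _ _ a_nonneg) as [a_pos | <-].
  (* The base is compared with the path through the apex: [f a <= f b + f b]. *)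
  - pose proof (is_metric_tri _ _
      (f_pres _ (isosceles_ultrametric a b a_pos a_le_b))
      (Some true) (Some false) None) as tri.
    simpl in tri; lra.
  (* For [a = 0] the base would collapse; here amenability gives [f 0 = 0]. *)
  - rewrite (proj2 (f_amenable 0 (Rle_refl 0)) eq_refl).
    pose proof (f_nonneg b a_le_b); lra.
Qed.

Lemma triplet_of_le_double (f : R -> R) (f_nonneg : nonneg_fun f) :
  (forall a b : R, 0 <= a -> a <= b -> f a <= 2 * f b) ->
  forall a b c : R, ultra_triangle_triplet a b c -> triangle_triplet (f a) (f b) (f c).
Proof.
  intros f_le a b c [[a_nonneg [b_nonneg c_nonneg]] [Ha [Hb Hc]]].
  pose proof (f_nonneg a a_nonneg); pose proof (f_nonneg b b_nonneg);
    pose proof (f_nonneg c c_nonneg).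
  assert (isosceles : (a = b /\ c <= a) \/ (b = c /\ a <= b) \/ (c = a /\ b <= c)).
  { unfold Rmax in *; repeat destruct Rle_dec; lra. }
  (* In each case [L] turns into the bound of the odd image by twice the repeated one; the other two
     inequalities follow from nonnegativity. *)
  destruct isosceles as [[E L] | [[E L] | [E L]]]; subst;
    apply f_le in L; trivial; unfold triangle_triplet; lra.
Qed.

Lemma le_double_of_triplet (f : R -> R) :
  (forall a b c : R, ultra_triangle_triplet a b c -> triangle_triplet (f a) (f b) (f c)) ->
  forall a b : R, 0 <= a -> a <= b -> f a <= 2 * f b.
Proof.
  intros f_trip a b a_nonneg a_le_b.
  destruct (f_trip a b b) as [_ [tri _]]; [| lra].
  unfold ultra_triangle_triplet, Rmax; repeat destruct Rle_dec; lra.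
Qed.

(** The three distances between any points of an ultrametric space form an ultra triangle triplet,
    and amenability carries over the separation of points. *)
Lemma preserving_of_triplet (f : R -> R) (f_nonneg : nonneg_fun f)
    (f_amenable : amenable f) :
  (forall a b c : R, ultra_triangle_triplet a b c -> triangle_triplet (f a) (f b) (f c)) ->
  ultrametric_metric_preserving f.
Proof.
  intros f_trip M M_ultra.
  assert (dist_nonneg : forall x y : Base M, 0 <= dist M x y)
    by (intros; apply Rge_le, dist_pos).
  split.
  - intros x y; apply Rle_ge, f_nonneg, dist_nonneg.
  - intros x y; now rewrite dist_sym.
  - intros x y; rewrite (f_amenable _ (dist_nonneg x y)); apply dist_refl.
  - intros x y z.
    apply (f_trip (dist M x y) (dist M x z) (dist M z y)).
    split; [auto | repeat split].
    + apply M_ultra.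
    + rewrite Rmax_comm, (dist_sym M z y); apply M_ultra.
    + rewrite Rmax_comm, (dist_sym M x z); apply M_ultra.
Qed.

Theorem theorem19 (f : R -> R) (f_nonneg : nonneg_fun f) (f_amenable : amenable f) :
  (ultrametric_metric_preserving f <->
     (forall a b c : R, ultra_triangle_triplet a b c -> triangle_triplet (f a) (f b) (f c))) /\
  ((forall a b c : R, ultra_triangle_triplet a b c -> triangle_triplet (f a) (f b) (f c)) <->
     (forall a b : R, 0 <= a -> a <= b -> f a <= 2 * f b)).
Proof.
  split; split.
  (* The isosceles spaces yield only the bound [f a <= 2 * f b], so this implication passes through
     it. *)
  - intro f_pres; apply triplet_of_le_double; trivial.
    now apply le_double_of_preserving.
  - now apply preserving_of_triplet.
  - apply le_double_of_triplet.
  - now apply triplet_of_le_double.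
Qed.
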